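(* Let $\mathbb{K}$ be a field of characteristic zero (e.g. $\mathbb{Q}$, $\mathbb{R}$ or $\mathbb{C}$), and let $X,Y$ be non-commuting indeterminates. In the algebra $\mathbb{K}\langle\langle X,Y\rangle\rangle$ of formal power series in $X,Y$, there is a unique sequence $(C_k)_{k\ge 2}$, with each $C_k=C_k(X,Y)$ a homogeneous Lie polynomial in $X$ and $Y$ of degree $k$, such that $$ {\rm e}^{X+Y} = {\rm e}^{\frac{X}{2}}\,{\rm e}^{\frac{Y}{2}}\,{\rm e}^{C_2}\,{\rm e}^{C_3}\cdots{\rm e}^{C_k}\cdots\,{\rm e}^{C_k}\cdots{\rm e}^{C_3}\,{\rm e}^{C_2}\,{\rm e}^{\frac{Y}{2}}\,{\rm e}^{\frac{X}{2}}, $$ i.e. ${\rm e}^{X+Y}={\rm e}^{X/2}{\rm e}^{Y/2}\Big(\prod_{n=2}^{\infty}{\rm e}^{C_n}\Big)\Big(\prod_{n=\infty}^{2}{\rm e}^{C_n}\Big){\rm e}^{Y/2}{\rm e}^{X/2}$, where the first product is ordered with increasing index from left to right and the second with decreasing index. Moreover, $C_{2k}=0$ for all $k\ge 1$, so that $$ {\rm e}^{X+Y} = {\rm e}^{\frac{X}{2}}\,{\rm e}^{\frac{Y}{2}}\,{\rm e}^{C_3}\,{\rm e}^{C_5}\cdots{\rm e}^{C_{2k+1}}\cdots\,{\rm e}^{C_{2k+1}}\cdots{\rm e}^{C_5}\,{\rm e}^{C_3}\,{\rm e}^{\frac{Y}{2}}\,{\rm e}^{\frac{X}{2}}. $$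
   Context: $\mathbb{K}\langle\langle X,Y\rangle\rangle$ denotes the unital associative algebra of formal power series in the two non-commuting variables $X,Y$ over $\mathbb{K}$, with commutator $[a,b]=ab-ba$. A Lie polynomial in $X,Y$ is any element obtained from $X$ and $Y$ by finitely many additions, multiplications by scalars in $\mathbb{K}$ and commutators; it is homogeneous of degree $k$ if every term contains exactly $k$ letters. The exponential of an element without constant term is defined by its power series, and the infinite products converge in the formal (degree-graded) topology since $C_k$ has degree $k$. *)

(* Defs.v *)
From mathcomp Require Import all_boot all_order all_algebra.
Set Implicit Arguments. Unset Strict Implicit. Unset Printing Implicit Defensive.
Import GRing.Theory.
Local Open Scope ring_scope.

(* Words over the alphabet {X, Y}: false = X, true = Y. *)
Definition word := seq bool.

(* A formal power series in K<<X,Y>> is its coefficient function on words. *)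
Definition series (K : fieldType) := word -> K.

Section Series.
Variable K : fieldType.

Definition sadd (f g : series K) : series K := fun w => f w + g w.
Definition sscale (a : K) (f : series K) : series K := fun w => a * f w.
Definition szero : series K := fun _ => 0.
Definition sone : series K := fun w => if w == [::] then 1 else 0.
Definition svar (b : bool) : series K := fun w => if w == [:: b] then 1 else 0.
Definition sX : series K := svar false.
Definition sY : series K := svar true.

Definition smul (f g : series K) : series K :=
  fun w => \sum_(i < (size w).+1) f (take i w) * g (drop i w).

Definition spow (f : series K) (n : nat) : series K := iter n (smul f) sone.

(* exponential, for f without constant term: the coefficient of a word w in
   sum_n f^n/n! only receives contributions from n <= size w. *)
Definition sexp (f : series K) : series K :=
  fun w => \sum_(n < (size w).+1) (n`!%:R)^-1 * spow f n w.

Definition sbracket (f g : series K) : series K :=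
  sadd (smul f g) (sscale (-1) (smul g f)).

Inductive is_lie_poly : series K -> Prop :=
| lie_X : is_lie_poly sX
| lie_Y : is_lie_poly sY
| lie_add f g : is_lie_poly f -> is_lie_poly g -> is_lie_poly (sadd f g)
| lie_scale a f : is_lie_poly f -> is_lie_poly (sscale a f)
| lie_bracket f g : is_lie_poly f -> is_lie_poly g -> is_lie_poly (sbracket f g).

Definition homogeneous (k : nat) (f : series K) : Prop :=
  forall w : word, size w != k -> f w = 0.

Definition sconverges (s : nat -> series K) (P : series K) : Prop :=
  forall w : word, exists N, forall M, (N <= M)%N -> s M w = P w.

Definition prod_inc (C : nat -> series K) (N : nat) : series K :=
  foldr (fun n acc => smul (sexp (C n)) acc) sone (iota 2 N.-1).
Definition prod_dec (C : nat -> series K) (N : nat) : series K :=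
  foldr (fun n acc => smul (sexp (C n)) acc) sone (rev (iota 2 N.-1)).

Definition symmetric_BCH_factorization (C : nat -> series K) : Prop :=
  (forall k, (2 <= k)%N -> is_lie_poly (C k) /\ homogeneous k (C k)) /\
  exists P Q : series K,
    sconverges (prod_inc C) P /\ sconverges (prod_dec C) Q /\
    sexp (sadd sX sY) =
      smul (sexp (sscale (2%:R)^-1 sX))
      (smul (sexp (sscale (2%:R)^-1 sY))
      (smul P
      (smul Q
      (smul (sexp (sscale (2%:R)^-1 sY))
            (sexp (sscale (2%:R)^-1 sX)))))).

End Series.

(* Main.v *)
Require Import Defs.
From HB Require Import structures.
From mathcomp Require Import all_boot all_order all_algebra.
From mathcomp Require Import boolp ring.
Set Implicit Arguments. Unset Strict Implicit. Unset Printing Implicit Defensive.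
Import GRing.Theory.
Local Open Scope ring_scope.

(* Let W = e^(-Y/2) e^(-X/2) e^(X+Y) e^(-X/2) e^(-Y/2) = 1 + O(2). Peeling off
   factors, R_2 = W and R_(k+1) = e^(-C_k) R_k e^(-C_k), where 2 C_k is the
   degree-k part of R_k, gives R_k = 1 + O(k); comparing degrees shows that this
   choice of C_k is forced.
   That C_k is a Lie polynomial is Dynkin's criterion r(c) = k c for the
   right-normed bracketing r. Let Ad be the algebra morphism with Ad(x) = ad x on
   letters, and E the degree derivation. Since r(fg) = Ad(f) r(g) + g(1) r(f), where
   g(1) is the constant term, the series g with constant term 1 such that
   Ad(g)(h) g = g h for all h and r(g) g = E(g) are closed under products; they
   contain the exponentials e^f of homogeneous Lie polynomials f of degree k > 0, as
   both sides of each identity solve the same linear differential equation, by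
   E(e^f) = k f e^f. In lowest degree, r(g) g = E(g) for g = R_k reads
   r(2 C_k) = k (2 C_k).
   Finally the automorphism s : X |-> -X, Y |-> -Y satisfies s(W) = W^-1, so
   that -s(C_k) is another solution, equal to C_k by uniqueness; hence C_k = 0 for
   even k. *)

(** * The associative algebra of noncommutative power series *)

Section SeriesRing.
Variable K : fieldType.
Implicit Types (f g h : series K) (w : word) (b : bool).

(** Removal of a first or last letter, the one-sided derivatives of formal language theory. They
    turn identities between products into inductions on words, without reindexing cut positions. *)
Definition lquo b f : series K := fun w => f (b :: w).
Definition rquo b f : series K := fun w => f (rcons w b).

Lemma smul_nil f g : smul f g [::] = f [::] * g [::].
Proof. by rewrite /smul big_ord_recl big_ord0 addr0. Qed.

Lemma smul_cons f g b w :
  smul f g (b :: w) = f [::] * g (b :: w) + smul (lquo b f) g w.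
Proof. by rewrite /smul big_ord_recl. Qed.

Lemma smul_rcons f g b w :
  smul f g (rcons w b) = smul f (rquo b g) w + f (rcons w b) * g [::].
Proof.
rewrite /smul size_rcons big_ord_recr /=; congr (_ + _); last first.
  by rewrite take_oversize ?drop_oversize ?size_rcons.
apply: eq_bigr => i _; rewrite /rquo; have iw : (i <= size w)%N by rewrite -ltnS.
by rewrite drop_rcons // -cats1 takel_cat.
Qed.

Lemma saddA : associative (@sadd K).
Proof. by move=> f g h; apply/funext => w; rewrite /sadd addrA. Qed.
Lemma saddC : commutative (@sadd K).
Proof. by move=> f g; apply/funext => w; rewrite /sadd addrC. Qed.
Lemma sadd0 : left_id (szero K) (@sadd K).
Proof. by move=> f; apply/funext => w; rewrite /sadd add0r. Qed.
Lemma saddN : left_inverse (szero K) (sscale (-1)) (@sadd K).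
Proof. by move=> f; apply/funext => w; rewrite /sadd /sscale mulN1r addNr. Qed.

Lemma smulDl : left_distributive (@smul K) (@sadd K).
Proof.
move=> f g h; apply/funext => w; rewrite /sadd /smul -big_split.
by apply: eq_bigr => i _; rewrite mulrDl.
Qed.
Lemma smulDr : right_distributive (@smul K) (@sadd K).
Proof.
move=> f g h; apply/funext => w; rewrite /sadd /smul -big_split.
by apply: eq_bigr => i _; rewrite mulrDr.
Qed.
Lemma smulZl a f g : smul (sscale a f) g = sscale a (smul f g).
Proof.
apply/funext => w; rewrite /sscale /smul big_distrr /=.
by apply: eq_bigr => i _; rewrite mulrA.
Qed.
Lemma smulZr a f g : smul f (sscale a g) = sscale a (smul f g).
Proof.
apply/funext => w; rewrite /sscale /smul big_distrr /=.
by apply: eq_bigr => i _; rewrite mulrCA.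
Qed.

Lemma smulA : associative (@smul K).
Proof.
move=> f g h; apply/funext => w; elim: w f g => [|b w IHw] f g.
  by rewrite !smul_nil mulrA.
rewrite !smul_cons smul_nil IHw.
have -> : lquo b (smul f g) =
    sadd (sscale (f [::]) (lquo b g)) (smul (lquo b f) g).
  by apply/funext => v; rewrite /lquo smul_cons.
by rewrite smulDl smulZl /sadd /sscale mulrDr mulrA addrA.
Qed.

Lemma smul1l : left_id (sone K) (@smul K).
Proof.
move=> f; apply/funext => w; rewrite /smul big_ord_recl take0 drop0 mul1r.
rewrite big1 ?addr0 // => i _.
by rewrite /sone -size_eq0 size_takel ?mul0r //; exact: ltn_ord.
Qed.
Lemma smul1r : right_id (sone K) (@smul K).
Proof.
move=> f; apply/funext => w.
rewrite /smul big_ord_recr /= take_size drop_size mulr1 big1 ?add0r // => i _.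
by rewrite /sone -size_eq0 size_drop subn_eq0 leqNgt ltn_ord mulr0.
Qed.

HB.instance Definition _ := gen_eqMixin (series K).
HB.instance Definition _ := gen_choiceMixin (series K).
HB.instance Definition _ :=
  GRing.isZmodule.Build (series K) saddA saddC sadd0 saddN.

Lemma sone_neq0 : sone K != 0 :> series K.
Proof.
by apply/eqP => /(congr1 (fun f : series K => f [::])) /eqP; rewrite oner_eq0.
Qed.

HB.instance Definition _ := GRing.Zmodule_isNzRing.Build (series K)
  smulA smul1l smul1r smulDl smulDr sone_neq0.

Lemma sscaleA a c f : sscale a (sscale c f) = sscale (a * c) f.
Proof. by apply/funext => w; rewrite /sscale mulrA. Qed.
Lemma sscale1 : left_id 1 (@sscale K).
Proof. by move=> f; apply/funext => w; rewrite /sscale mul1r. Qed.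
Lemma sscaleDr : right_distributive (@sscale K) (@sadd K).
Proof. by move=> a f g; apply/funext => w; rewrite /sscale /sadd mulrDr. Qed.
Lemma sscaleDl f : {morph (@sscale K)^~ f : a c / a + c >-> sadd a c}.
Proof. by move=> a c; apply/funext => w; rewrite /sscale /sadd mulrDl. Qed.

HB.instance Definition _ := GRing.Zmodule_isLmodule.Build K (series K)
  sscaleA sscale1 sscaleDr sscaleDl.
HB.instance Definition _ := GRing.Lmodule_isLalgebra.Build K (series K)
  (fun a f g => esym (smulZl a f g)).
HB.instance Definition _ := GRing.Lalgebra_isAlgebra.Build K (series K)
  (fun a f g => esym (smulZr a f g)).
End SeriesRing.

(** * The degree filtration, homogeneous series and the Euler derivation *)

Section Order.
Variable K : fieldType.
Implicit Types (f g h : series K) (w : word) (b : bool) (k m n : nat).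

Lemma saddE f g w : (f + g) w = f w + g w. Proof. by []. Qed.
Lemma sscaleE a f w : (a *: f) w = a * f w. Proof. by []. Qed.
Lemma soppE f w : (- f) w = - f w. Proof. exact: mulN1r. Qed.
Lemma ssumE (I : Type) (r : seq I) (F : I -> series K) w :
  (\sum_(i <- r) F i) w = \sum_(i <- r) F i w.
Proof. by elim/big_rec2: _ => // i _ f _ <-. Qed.
Lemma smulE f g w :
  (f * g) w = \sum_(i < (size w).+1) f (take i w) * g (drop i w).
Proof. by []. Qed.
Lemma smulE0 f g : (f * g) [::] = f [::] * g [::].
Proof. exact: smul_nil. Qed.

(** The degree filtration: [f] is O(n). Equalities of series are proved modulo every step of it, by
    [vanish_eq0]. *)
Definition vanish n f := forall w, (size w < n)%N -> f w = 0.

Lemma vanish0 n : vanish n 0. Proof. by []. Qed.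
Lemma vanishD n f g : vanish n f -> vanish n g -> vanish n (f + g).
Proof. by move=> vf vg w wn; rewrite saddE vf ?vg ?addr0. Qed.
Lemma vanishZ n a f : vanish n f -> vanish n (a *: f).
Proof. by move=> vf w wn; rewrite sscaleE vf ?mulr0. Qed.
Lemma vanishN n f : vanish n f -> vanish n (- f).
Proof. by move=> vf w wn; rewrite soppE vf ?oppr0. Qed.
Lemma vanishB n f g : vanish n f -> vanish n g -> vanish n (f - g).
Proof. by move=> vf vg; apply/vanishD/vanishN. Qed.
Lemma vanish_sum n (I : Type) (r : seq I) (F : I -> series K) :
  (forall i, vanish n (F i)) -> vanish n (\sum_(i <- r) F i).
Proof. by move=> vF w wn; rewrite ssumE big1 // => i _; rewrite vF. Qed.
Lemma vanishW m n f : (m <= n)%N -> vanish n f -> vanish m f.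
Proof. by move=> mn vf w wm; apply/vf/(leq_trans wm). Qed.
Lemma vanishM m n f g : vanish m f -> vanish n g -> vanish (m + n) (f * g).
Proof.
move=> vf vg w wmn; apply: big1 => i _.
have iw : (i <= size w)%N by rewrite -ltnS.
have [im|mi] := ltnP i m; first by rewrite vf ?mul0r // size_takel.
by rewrite vg ?mulr0 // size_drop ltn_subLR // (leq_trans wmn) // leq_add2r.
Qed.
Lemma vanishMl n f g : vanish n f -> vanish n (f * g).
Proof. by move=> vf; rewrite -[n]addn0; apply: vanishM. Qed.
Lemma vanishMr n f g : vanish n g -> vanish n (f * g).
Proof. by move=> vg; rewrite -[n]add0n; apply: vanishM. Qed.
Lemma vanish_eq0 f : (forall n, vanish n f) -> f = 0.
Proof. by move=> vf; apply/funext => w; apply: (vf (size w).+1). Qed.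

Lemma homogeneous_vanish k f : homogeneous k f -> vanish k f.
Proof. by move=> hf w wk; rewrite hf // ltn_eqF. Qed.
Lemma homogeneous_eq0 k f : homogeneous k f -> vanish k.+1 f -> f = 0.
Proof.
move=> hf vf; apply/funext => w.
by have [wk|wk] := eqVneq (size w) k; [rewrite vf ?wk | rewrite hf].
Qed.
Lemma homogeneous1 : homogeneous 0 (1 : series K).
Proof. by move=> w; rewrite size_eq0 => /negPf w0; rewrite /GRing.one /= /sone w0. Qed.
Lemma homogeneous_var b : homogeneous 1 (svar K b).
Proof. by move=> w w1; rewrite /svar ifN //; apply: contraNneq w1 => ->. Qed.
Lemma homogeneousD k f g :
  homogeneous k f -> homogeneous k g -> homogeneous k (f + g).
Proof. by move=> hf hg w wk; rewrite saddE hf ?hg ?addr0. Qed.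
Lemma homogeneousZ k a f : homogeneous k f -> homogeneous k (a *: f).
Proof. by move=> hf w wk; rewrite sscaleE hf ?mulr0. Qed.
Lemma homogeneousM k m f g :
  homogeneous k f -> homogeneous m g -> homogeneous (k + m) (f * g).
Proof.
move=> hf hg w wkm; apply: big1 => i _.
have iw : (i <= size w)%N by rewrite -ltnS.
have [ik|ik] := eqVneq (i : nat) k; last by rewrite hf ?mul0r // size_takel.
by rewrite hg ?mulr0 // size_drop; apply: contraNneq wkm => <-; rewrite -ik subnKC.
Qed.
Lemma homogeneousX k f n : homogeneous k f -> homogeneous (k * n) (f ^+ n).
Proof.
move=> hf; elim: n => [|n IHn]; first by rewrite muln0; exact: homogeneous1.
by rewrite exprS mulnS; apply: homogeneousM.
Qed.

Definition hpart n f : series K := fun w => if size w == n then f w else 0.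

Lemma homogeneous_hpart n f : homogeneous n (hpart n f).
Proof. by move=> w /negPf wn; rewrite /hpart wn. Qed.
Lemma vanish_hpart n f : vanish n f -> vanish n.+1 (f - hpart n f).
Proof.
move=> vf w; rewrite ltnS leq_eqVlt saddE soppE /hpart.
have [_ _|_ /= wn] := eqVneq (size w) n; first by rewrite subrr.
by rewrite vf ?subr0.
Qed.

(* The derivation multiplying the degree-[n] part by [n]. *)
Definition euler f : series K := fun w => (size w)%:R * f w.

Lemma eulerD f g : euler (f + g) = euler f + euler g.
Proof. by apply/funext => w; rewrite /euler !saddE mulrDr. Qed.
Lemma eulerZ a f : euler (a *: f) = a *: euler f.
Proof. by apply/funext => w; rewrite /euler !sscaleE mulrCA. Qed.
Lemma eulerN f : euler (- f) = - euler f.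
Proof. by rewrite -scaleN1r eulerZ scaleN1r. Qed.
Lemma eulerB f g : euler (f - g) = euler f - euler g.
Proof. by rewrite eulerD eulerN. Qed.
Lemma euler0 : euler 0 = 0.
Proof. by apply/funext => w; apply: mulr0. Qed.
Lemma euler_sum (I : Type) (r : seq I) (F : I -> series K) :
  euler (\sum_(i <- r) F i) = \sum_(i <- r) euler (F i).
Proof. exact: (big_morph _ eulerD euler0). Qed.
Lemma eulerM f g : euler (f * g) = euler f * g + f * euler g.
Proof.
apply/funext => w; rewrite /euler saddE !smulE -big_split big_distrr /=.
apply: eq_bigr => i _; have iw : (i <= size w)%N by rewrite -ltnS.
rewrite /euler size_takel // size_drop [X in _ + X]mulrCA -mulrA -mulrDl.
by rewrite -natrD subnKC.
Qed.
Lemma euler_homogeneous k f : homogeneous k f -> euler f = k%:R *: f.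
Proof.
move=> hf; apply/funext => w; rewrite /euler sscaleE.
by have [->|wk] := eqVneq (size w) k; rewrite // hf ?mulr0.
Qed.

(* Differential equations for [euler] have at most one solution with given
   low order terms. *)
Lemma euler_ode_eq0 k n f g : [pchar K] =i pred0 -> (0 < k)%N ->
  homogeneous k g -> vanish n.+1 f -> euler f = g * f + n%:R *: f -> f = 0.
Proof.
move=> /pcharf0P pK k0 hg vf ef; apply: vanish_eq0; elim=> [//|m IHm].
have [/vanishW|nm] := leqP m.+1 n.+1; first exact.
rewrite ltnS in nm.
move=> w; rewrite ltnS leq_eqVlt => /orP[/eqP wm|]; last exact: IHm.
have /eqP := congr1 (fun f : series K => f w) ef.
(* The product [g * f] has order at least k + m > m, so a word of length m only sees (m - n) f(w) =
   0, where m - n is nonzero in characteristic zero. *)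
rewrite saddE sscaleE /euler (vanishM (homogeneous_vanish hg) IHm) ?add0r; last first.
  by rewrite wm -[ltnLHS]add0n ltn_add2r.
rewrite -subr_eq0 -mulrBl wm -natrB; last by rewrite ltnW.
by rewrite mulf_eq0 pK subn_eq0 leqNgt nm /= => /eqP.
Qed.

End Order.

(** * Exponentials of homogeneous series and the sign automorphism *)

Section Exponential.
Variable K : fieldType.
Implicit Types (f g h : series K) (w : word) (b : bool) (k m n : nat).

Lemma vanish_euler n f : vanish n f -> vanish n (euler f).
Proof. by move=> vf w wn; rewrite /euler vf ?mulr0. Qed.

Lemma spowE f n : spow f n = f ^+ n.
Proof. by elim: n => //= n IHn; rewrite exprS -IHn. Qed.

Lemma sexp_nil f : sexp f [::] = 1.
Proof. by rewrite /sexp big_ord_recl big_ord0 fact0 invr1 addr0 mul1r. Qed.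

(** In [sexp] the number of terms depends on the word. A fixed polynomial in [f] can be handled
    algebraically, and for [f] homogeneous of positive degree it agrees with [sexp f] below degree
    m. *)
Definition exp_trunc f m : series K := \sum_(n < m) n`!%:R^-1 *: f ^+ n.

(** The power [f ^+ n] is homogeneous of degree k n >= n, hence 0 on words shorter than n. *)
Lemma vanish_sexp_trunc k f m : (0 < k)%N -> homogeneous k f ->
  vanish m (sexp f - exp_trunc f m).
Proof.
move=> k0 hf w wm; rewrite saddE soppE /exp_trunc ssumE /sexp.
rewrite (big_ord_widen m (fun n => n`!%:R^-1 * spow f n w)) // big_mkcond -sumrB.
apply: big1 => n _; rewrite spowE sscaleE.
case: ifPn => [_|]; first by rewrite subrr.
rewrite -leqNgt => wn; rewrite (homogeneousX hf) ?mulr0 ?subr0 //.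
by rewrite ltn_eqF // (leq_trans wn) // leq_pmull.
Qed.

Lemma exp_trunc_comm f m : f * exp_trunc f m = exp_trunc f m * f.
Proof.
rewrite /exp_trunc big_distrl big_distrr /=; apply: eq_bigr => n _.
by rewrite -scalerAl -scalerAr -exprS exprSr.
Qed.

Lemma sexp_comm k f : (0 < k)%N -> homogeneous k f -> f * sexp f = sexp f * f.
Proof.
move=> k0 hf; apply/eqP; rewrite -subr_eq0; apply/eqP/vanish_eq0 => n.
have vn := vanish_sexp_trunc (m := n) k0 hf.
rewrite -[sexp f](subrK (exp_trunc f n)) mulrDl mulrDr exp_trunc_comm.
rewrite opprD addrACA subrr addr0.
by apply: vanishB; [apply: vanishMr | apply: vanishMl].
Qed.

Hypothesis pK : [pchar K] =i pred0.

Lemma natr_char0_neq0 n : (0 < n)%N -> n%:R != 0 :> K.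
Proof. by move/pcharf0P: pK => ->; rewrite lt0n. Qed.

(** The power [f ^+ n] is an eigenvector of [euler] for k n, and k n / n! = k / (n-1)! shifts the
    sum by one. *)
Lemma euler_exp_trunc k f m : homogeneous k f ->
  euler (exp_trunc f m.+1) = k%:R *: (f * exp_trunc f m).
Proof.
move=> hf; rewrite /exp_trunc euler_sum big_ord_recl.
rewrite !eulerZ (euler_homogeneous (homogeneousX (n := 0) hf)) muln0 scale0r scaler0 add0r.
rewrite big_distrr scaler_sumr /=; apply: eq_bigr => n _.
rewrite eulerZ (euler_homogeneous (homogeneousX hf)) -scalerAr -exprS !scalerA.
congr (_ *: _); rewrite /bump add1n factS !natrM invfM mulrCA [_ * n.+1%:R]mulrAC.
by rewrite mulVf ?mul1r // natr_char0_neq0.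
Qed.

Lemma euler_sexp k f : (0 < k)%N -> homogeneous k f ->
  euler (sexp f) = k%:R *: (f * sexp f).
Proof.
move=> k0 hf; apply/eqP; rewrite -subr_eq0; apply/eqP/vanish_eq0 => n.
have vn m := vanish_sexp_trunc (m := m) k0 hf.
rewrite -{1}[sexp f](subrK (exp_trunc f n.+1)) -[X in f * X](subrK (exp_trunc f n)).
rewrite eulerD mulrDr scalerDr (euler_exp_trunc _ hf) opprD addrACA subrr addr0.
apply: vanishB; first by apply/vanish_euler/(vanishW (leqnSn n)).
by apply/vanishZ/vanishMr.
Qed.

(** By commutation the two Leibniz terms cancel, so e^(-f) e^f - 1 has Euler derivative 0 and
    constant term 0. *)
Lemma sexp_inv k f : (0 < k)%N -> homogeneous k f -> sexp (- f) * sexp f = 1.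
Proof.
move=> k0 hf; have hNf : homogeneous k (- f).
  by rewrite -scaleN1r; apply: homogeneousZ.
apply/eqP; rewrite -subr_eq0; apply/eqP.
apply: (@euler_ode_eq0 K 1 0 _ 0) => //.
  by case=> // _; rewrite saddE soppE smulE0 !sexp_nil mulr1 subrr.
rewrite eulerB eulerM (euler_sexp _ hNf) // (sexp_comm _ hNf) // (euler_sexp _ hf) //.
rewrite -(scalerAl k%:R) -(scalerAr k%:R) -scalerDr !mulrA mulrN mulNr addNr scaler0.
by rewrite (euler_homogeneous (@homogeneous1 K)) scale0r mul0r scale0r subrr addr0.
Qed.

Lemma sexp_lead k f : (0 < k)%N -> homogeneous k f ->
  vanish k.+1 (sexp f - (1 + f)).
Proof.
move=> k0 hf; have vn := vanish_sexp_trunc (m := k.+2) k0 hf.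
rewrite -[sexp f](subrK (exp_trunc f k.+2)) -addrA.
apply: vanishD; first exact: (vanishW _ vn).
rewrite /exp_trunc !big_ord_recl /= invr1 !scale1r expr0 expr1 addrA [X in X - _]addrC.
rewrite addrK; apply: vanish_sum => i; apply: vanishZ.
apply/(vanishW _ (homogeneous_vanish (homogeneousX hf))).
rewrite /bump /= !add1n mulnSr -addn1 addnC leq_add2r.
by rewrite mulnSr (leq_trans k0) // leq_addl.
Qed.

(* The automorphism X |-> -X, Y |-> -Y. *)
Definition antip f : series K := fun w => (-1) ^+ size w * f w.

Lemma antipM f g : antip (f * g) = antip f * antip g.
Proof.
apply/funext => w; rewrite /antip !smulE big_distrr /=; apply: eq_bigr => i _.
have iw : (i <= size w)%N by rewrite -ltnS.
rewrite size_takel // size_drop mulrACA -exprD subnKC //.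
Qed.
Lemma antipB f g : antip (f - g) = antip f - antip g.
Proof. by apply/funext => w; rewrite /antip !(saddE, soppE) mulrBr. Qed.
Lemma antip_homogeneous k f : homogeneous k f -> antip f = (-1) ^+ k *: f.
Proof.
move=> hf; apply/funext => w; rewrite /antip sscaleE.
by have [->|wk] := eqVneq (size w) k; rewrite // hf ?mulr0.
Qed.
Lemma antip1 : antip 1 = 1.
Proof. by rewrite (antip_homogeneous (@homogeneous1 K)) scale1r. Qed.
Lemma antipX f n : antip (f ^+ n) = antip f ^+ n.
Proof. by elim: n => [|n IHn]; rewrite ?antip1 // !exprS antipM IHn. Qed.
Lemma antip_sexp f : antip (sexp f) = sexp (antip f).
Proof.
apply/funext => w; rewrite /antip /sexp big_distrr /=; apply: eq_bigr => n _.
by rewrite !spowE -antipX mulrCA.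
Qed.
Lemma vanish_antip n f : vanish n f -> vanish n (antip f).
Proof. by move=> vf w wn; rewrite /antip vf ?mulr0. Qed.

End Exponential.

(* Solves linear identities between series, with products of series as atoms. *)
Ltac sring := apply/funext => w; rewrite !(saddE, soppE, sscaleE); ring.

(** * The adjoint action of series and the Dynkin operator *)

Section Dynkin.
Variable K : fieldType.
Implicit Types (f g h : series K) (w : word) (b : bool) (k m n : nat).

Lemma lquoM b f g : lquo b (f * g) = f [::] *: lquo b g + lquo b f * g.
Proof. by apply/funext => w; apply: smul_cons. Qed.
Lemma rquoM b f g : rquo b (f * g) = f * rquo b g + g [::] *: rquo b f.
Proof. by apply/funext => w; rewrite saddE sscaleE [g [::] * _]mulrC; apply: smul_rcons. Qed.
Lemma lquo_euler b f : lquo b (euler f) = euler (lquo b f) + lquo b f.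
Proof. by apply/funext => w; rewrite saddE /lquo /euler mulrSr mulrDl mul1r. Qed.
Lemma rquo_euler b f : rquo b (euler f) = euler (rquo b f) + rquo b f.
Proof.
by apply/funext => w; rewrite saddE /rquo /euler size_rcons mulrSr mulrDl mul1r.
Qed.
Lemma lquo_homogeneous b k f : homogeneous k.+1 f -> homogeneous k (lquo b f).
Proof. by move=> hf w wk; apply: hf. Qed.
Lemma rquo_homogeneous b k f : homogeneous k.+1 f -> homogeneous k (rquo b f).
Proof. by move=> hf w wk; apply: hf; rewrite size_rcons. Qed.
Lemma lquo_var b c : lquo b (svar K c) = (b == c)%:R *: 1.
Proof.
apply/funext => w; rewrite /lquo sscaleE /svar eqseq_cons /GRing.one /= /sone.
by case: eqP; case: eqP; rewrite ?mul1r ?mul0r ?mulr0.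
Qed.
Lemma rquo_var b c : rquo b (svar K c) = (b == c)%:R *: 1.
Proof.
apply/funext => w; rewrite /rquo sscaleE /svar -[[:: c]]/(rcons [::] c) eqseq_rcons.
rewrite andbC /GRing.one /= /sone.
by case: eqP; case: eqP; rewrite ?mul1r ?mul0r ?mulr0.
Qed.

(** The recursion step of [Ad]. It raises the order by one, which makes recursions through it
    contractions for the degree filtration. *)
Definition commvar (F : bool -> series K) : series K :=
  \sum_b (svar K b * F b - F b * svar K b).

Lemma commvarZD a (F G : bool -> series K) :
  commvar (fun b => a *: F b + G b) = a *: commvar F + commvar G.
Proof.
rewrite /commvar scaler_sumr -big_split; apply: eq_bigr => b _ /=.
rewrite mulrDr mulrDl scalerBr opprD -scalerAr -scalerAl.
by rewrite addrACA.
Qed.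

Lemma vanish_commvar n (F : bool -> series K) :
  (forall b, vanish n (F b)) -> vanish n.+1 (commvar F).
Proof.
move=> vF; apply: vanish_sum => b; have vb := homogeneous_vanish (@homogeneous_var K b).
by apply: vanishB; [rewrite -add1n | rewrite -addn1]; apply: vanishM.
Qed.

(** Reading [f] from its first letter, each letter costs one bracket, hence one degree. Depth n is
    therefore exact on words of length at most n, although the recursion on a whole series would not
    terminate. *)
Fixpoint ad_approx n f h : series K :=
  if n is m.+1 then f [::] *: h + commvar (fun b => ad_approx m (lquo b f) h)
  else f [::] *: h.

(* The action of the series [f] on [h] through [x_1 ... x_n |-> ad x_1 ... ad x_n]. *)
Definition Ad f h : series K := fun w => ad_approx (size w) f h w.

Lemma ad_approx_vanish m n f h : (m <= n)%N ->
  vanish m.+1 (ad_approx n f h - ad_approx m f h).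
Proof.
elim: m n f => [|m IHm] [|n] f //= mn.
- by rewrite subrr.
- by rewrite [X in X - _]addrC addrK; apply: vanish_commvar => b; move.
rewrite opprD addrACA subrr add0r -scaleN1r addrC -commvarZD.
by apply: vanish_commvar => b; rewrite addrC scaleN1r; apply: IHm.
Qed.

Lemma Ad_approx m f h : vanish m.+1 (Ad f h - ad_approx m f h).
Proof.
move=> w; rewrite ltnS => wm; rewrite saddE soppE /Ad.
have /(_ w (ltnSn _)) := @ad_approx_vanish _ _ f h wm.
by rewrite saddE soppE => /eqP; rewrite subr_eq0 => /eqP ->; rewrite subrr.
Qed.

(** The fixed-point equation of [Ad]. Together with [commvar_fix_eq0] it replaces all further work
    with the approximations. *)
Lemma AdE f h : Ad f h = f [::] *: h + commvar (fun b => Ad (lquo b f) h).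
Proof.
apply/eqP; rewrite -subr_eq0; apply/eqP/vanish_eq0 => n.
apply: (@vanishW _ _ n.+2); first by rewrite leqW.
rewrite -[Ad f h](subrK (ad_approx n.+1 f h)) -addrA.
apply: vanishD; first exact: Ad_approx.
rewrite /= opprD addrACA subrr add0r -scaleN1r addrC -commvarZD.
apply: vanish_commvar => b; rewrite addrC scaleN1r -opprB.
exact/vanishN/Ad_approx.
Qed.

(** A solution of the recursion has arbitrarily high order. This is applied to the difference of the
    two sides of an identity, with [I] recording the series that are replaced by their quotients. *)
Lemma commvar_fix_eq0 (I : Type) (D : I -> series K) (s : bool -> I -> I) :
  (forall i, D i = commvar (fun b => D (s b i))) -> forall i, D i = 0.
Proof.
move=> DE i; apply: vanish_eq0 => n; elim: n i => // n IHn i.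
by rewrite DE; apply: vanish_commvar => b.
Qed.

Lemma commvarB (F G : bool -> series K) :
  commvar F - commvar G = commvar (fun b => F b - G b).
Proof.
rewrite -scaleN1r addrC -commvarZD; congr commvar; apply/funext => b.
by rewrite scaleN1r addrC.
Qed.
Lemma commvarD (F G : bool -> series K) :
  commvar F + commvar G = commvar (fun b => F b + G b).
Proof.
rewrite -[commvar F]scale1r -commvarZD; congr commvar; apply/funext => b.
by rewrite scale1r.
Qed.

Lemma AdZDl a f g h : Ad (a *: f + g) h = a *: Ad f h + Ad g h.
Proof.
apply/eqP; rewrite -subr_eq0; apply/eqP.
(* Both series lose their first letter together, hence the indexing by pairs. *)
apply: (@commvar_fix_eq0 (series K * series K)
  (fun p => Ad (a *: p.1 + p.2) h - (a *: Ad p.1 h + Ad p.2 h))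
  (fun b p => (lquo b p.1, lquo b p.2)) _ (f, g)) => -[{}f {}g] /=.
rewrite (AdE (_ + _)) (AdE f) (AdE g) scalerDr scalerA addrACA opprD addrACA.
by rewrite -scalerDl subrr add0r -commvarZD commvarB.
Qed.

Lemma AdZDr a f g h : Ad f (a *: g + h) = a *: Ad f g + Ad f h.
Proof.
apply/eqP; rewrite -subr_eq0; apply/eqP.
apply: (@commvar_fix_eq0 _
  (fun f => Ad f (a *: g + h) - (a *: Ad f g + Ad f h)) (@lquo K)) => {}f.
rewrite (AdE f (_ + _)) (AdE f g) (AdE f h) scalerDr !(scalerDr a) scalerA addrACA.
rewrite opprD addrACA mulrC -scalerA.
by rewrite subrr add0r -commvarZD commvarB.
Qed.

Lemma AdDl f g h : Ad (f + g) h = Ad f h + Ad g h.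
Proof. by have := AdZDl 1 f g h; rewrite !scale1r. Qed.
Lemma AdDr f g h : Ad f (g + h) = Ad f g + Ad f h.
Proof. by have := AdZDr 1 f g h; rewrite !scale1r. Qed.
Lemma Ad0l h : Ad 0 h = 0.
Proof. by apply: (addrI (Ad 0 h)); rewrite -AdDl !addr0. Qed.
Lemma Ad0r f : Ad f 0 = 0.
Proof. by apply: (addrI (Ad f 0)); rewrite -AdDr !addr0. Qed.
Lemma AdZl a f h : Ad (a *: f) h = a *: Ad f h.
Proof. by have := AdZDl a f 0 h; rewrite Ad0l !addr0. Qed.
Lemma AdZr a f h : Ad f (a *: h) = a *: Ad f h.
Proof. by have := AdZDr a f h 0; rewrite Ad0r !addr0. Qed.
Lemma AdBr f g h : Ad f (g - h) = Ad f g - Ad f h.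
Proof. by rewrite AdDr -scaleN1r AdZr scaleN1r. Qed.
Lemma Ad_sumr (I : Type) (r : seq I) f (F : I -> series K) :
  Ad f (\sum_(i <- r) F i) = \sum_(i <- r) Ad f (F i).
Proof. exact: (big_morph _ (AdDr f) (Ad0r f)). Qed.

Lemma AdM f g h : Ad (f * g) h = Ad f (Ad g h).
Proof.
apply/eqP; rewrite -subr_eq0; apply/eqP.
apply: (@commvar_fix_eq0 _
  (fun f => Ad (f * g) h - Ad f (Ad g h)) (@lquo K)) => {}f.
rewrite (AdE (f * g)) (AdE f) {1}(AdE g) smulE0.
(* By [lquoM], the first letter comes from [g] when [f] contributes the empty word; these terms and
   the constant one rebuild [f [::] *: Ad g h]. *)
rewrite -commvarB (_ : commvar _ = f [::] *: commvar (fun b => Ad (lquo b g) h) +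
  commvar (fun b => Ad (lquo b f * g) h)); first by sring.
by rewrite -commvarZD; congr commvar; apply/funext => b; rewrite lquoM AdZDl.
Qed.

Lemma Ad1 h : Ad 1 h = h.
Proof.
rewrite AdE scale1r; rewrite -[RHS]addr0; congr (_ + _); apply: big1 => b _.
have -> : lquo b (1 : series K) = 0 by apply/funext.
by rewrite Ad0l mulr0 mul0r subrr.
Qed.

Lemma Ad_var b h : Ad (svar K b) h = svar K b * h - h * svar K b.
Proof.
rewrite AdE scale0r add0r /commvar (bigD1 b) //= big1 ?addr0.
  by rewrite lquo_var eqxx scale1r Ad1.
by move=> c /negPf cb; rewrite lquo_var cb scale0r Ad0l mulr0 mul0r subrr.
Qed.

Lemma euler_commvar (F : bool -> series K) :
  euler (commvar F) = commvar F + commvar (fun b => euler (F b)).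
Proof.
rewrite euler_sum -big_split; apply: eq_bigr => b _ /=.
rewrite eulerB !eulerM !(euler_homogeneous (@homogeneous_var _ _)) !scale1r.
by rewrite addrACA opprD [- _ + - _]addrC addrACA; congr (_ + _); rewrite addrC.
Qed.

Lemma euler_Ad f h : euler (Ad f h) = Ad (euler f) h + Ad f (euler h).
Proof.
apply/eqP; rewrite -subr_eq0; apply/eqP.
apply: (@commvar_fix_eq0 _
  (fun f => euler (Ad f h) - (Ad (euler f) h + Ad f (euler h))) (@lquo K)) => {}f.
rewrite (AdE f h) (AdE (euler f)) (AdE f (euler h)) [euler f [::]]mul0r scale0r add0r.
rewrite eulerD eulerZ euler_commvar -commvarB -commvarD.
rewrite (_ : commvar (fun b => Ad (lquo b (euler f)) h) =
  commvar (fun b => Ad (euler (lquo b f)) h) + commvar (fun b => Ad (lquo b f) h)).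
  by sring.
by rewrite commvarD; congr commvar; apply/funext => b; rewrite lquo_euler AdDl.
Qed.

(* The Dynkin operator [x_1 ... x_n |-> [x_1, [x_2, ... [x_(n-1), x_n] ... ] ] ]. *)
Definition dynkin f : series K := \sum_b Ad (rquo b f) (svar K b).

Lemma dynkinZD a f g : dynkin (a *: f + g) = a *: dynkin f + dynkin g.
Proof.
rewrite /dynkin scaler_sumr -big_split; apply: eq_bigr => b _ /=.
by rewrite -AdZDl.
Qed.
(** The last letter of a word of f g lies in g, or in f when g contributes its constant term; the
    letters before it act through [Ad]. *)
Lemma dynkinM f g : dynkin (f * g) = Ad f (dynkin g) + g [::] *: dynkin f.
Proof.
rewrite /dynkin Ad_sumr scaler_sumr -big_split; apply: eq_bigr => b _ /=.
by rewrite rquoM AdDl AdM AdZl.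
Qed.
Lemma dynkin_var b : dynkin (svar K b) = svar K b.
Proof.
rewrite /dynkin (bigD1 b) //= big1 ?addr0.
  by rewrite rquo_var eqxx scale1r Ad1.
by move=> c /negPf cb; rewrite rquo_var cb scale0r Ad0l.
Qed.
Lemma euler_dynkin f : euler (dynkin f) = dynkin (euler f).
Proof.
rewrite euler_sum; apply: eq_bigr => b _.
rewrite euler_Ad rquo_euler (euler_homogeneous (@homogeneous_var _ _)) scale1r.
by rewrite -AdDl.
Qed.
Lemma vanish_Ad n m f h : vanish n f -> vanish m h -> vanish (n + m) (Ad f h).
Proof.
move=> vf vh; elim: n f vf => [|n IHn] f vf.
  (* At n = 0 the order of [h] is propagated one degree at a time, for all [f] at once, since [AdE]
     passes to quotients. *)
  clear vf; suff vj j : (j <= m)%N -> forall f, vanish j (Ad f h) by apply: vj.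
  elim: j => // j IHj jm {}f; rewrite AdE; apply: vanishD.
    exact/vanishZ/(vanishW jm).
  by apply: vanish_commvar => b; apply/IHj/ltnW.
rewrite AdE vf // scale0r add0r; apply: vanish_commvar => b.
by apply: IHn => w wn; apply: vf.
Qed.
Lemma vanish_dynkin n f : vanish n f -> vanish n (dynkin f).
Proof.
(* The right quotient loses one letter and bracketing with that letter restores the degree;
   [leqSpred] also covers n = 0. *)
move=> vf; apply: vanish_sum => b; apply: (vanishW (leqSpred n)).
rewrite -addn1; apply: vanish_Ad (homogeneous_vanish (@homogeneous_var K b)).
by case: n vf => // n vf w wn; apply: vf; rewrite size_rcons.
Qed.
Lemma vanish1_dynkin f : vanish 1 (dynkin f).
Proof.
apply: vanish_sum => b.
by rewrite -[1%N]add0n; apply: vanish_Ad (homogeneous_vanish (@homogeneous_var K b)).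
Qed.
Lemma dynkin1 : dynkin 1 = 0.
Proof.
apply: big1 => b _; suff -> : rquo b (1 : series K) = 0 by exact: Ad0l.
by apply/funext => -[].
Qed.
Lemma dynkinZ a f : dynkin (a *: f) = a *: dynkin f.
Proof.
rewrite /dynkin scaler_sumr; apply: eq_bigr => b _.
by rewrite -AdZl.
Qed.
Lemma dynkinD f g : dynkin (f + g) = dynkin f + dynkin g.
Proof. by have := dynkinZD 1 f g; rewrite !scale1r. Qed.

End Dynkin.

(** * Group-like series and Dynkin's criterion *)

Section GroupLike.
Variable K : fieldType.
Hypothesis pK : [pchar K] =i pred0.
Implicit Types (f g h : series K) (w : word) (b : bool) (k m n : nat).

(* Primitive elements, for which Dynkin's criterion holds; [group_like] below is
   the corresponding notion for their exponentials, closed under products. *)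
Definition lie_like f :=
  [/\ f [::] = 0, forall h, Ad f h = f * h - h * f & dynkin f = euler f].

Lemma lie_likeZ a f : lie_like f -> lie_like (a *: f).
Proof.
case=> f0 Adf df; split=> [|h|]; first by rewrite sscaleE f0 mulr0.
  by rewrite AdZl Adf scalerBr -scalerAl -scalerAr.
by rewrite dynkinZ df eulerZ.
Qed.
Lemma lie_likeD f g : lie_like f -> lie_like g -> lie_like (f + g).
Proof.
case=> f0 Adf df [g0 Adg dg]; split=> [|h|]; first by rewrite saddE f0 g0 addr0.
  by rewrite AdDl Adf Adg mulrDl mulrDr; sring.
by rewrite dynkinD df dg eulerD.
Qed.

(** For brackets the second condition is the Jacobi identity, and [dynkinM] gives r([f, g]) =
    [f, E(g)] - [g, E(f)] = E([f, g]). *)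
Lemma is_lie_poly_like f : is_lie_poly f -> lie_like f.
Proof.
have lv b : lie_like (svar K b).
  split=> //; first exact: Ad_var.
  by rewrite dynkin_var (euler_homogeneous (@homogeneous_var _ _)) scale1r.
elim=> [||{}f g _ lf _ lg|a {}f _ lf|{}f g _ [f0 Adf df] _ [g0 Adg dg]].
- exact: lv.
- exact: lv.
- exact: lie_likeD.
- exact: lie_likeZ.
rewrite -[sbracket f g]/(f * g - g * f) -scaleN1r.
split=> [|h|]; first by rewrite saddE sscaleE !smulE0 f0 g0 !mul0r mulr0 addr0.
  rewrite AdDl AdZl !AdM !(Adf, Adg) !(mulrDl, mulrDr, mulrN, mulNr, mulrA).
  by sring.
rewrite dynkinD dynkinZ !dynkinM f0 g0 Adf Adg df dg eulerD eulerZ !eulerM.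
by sring.
Qed.

Definition group_like g :=
  [/\ g [::] = 1, forall h, Ad g h * g = g * h & dynkin g * g = euler g].

(** The conjugation condition turns [Ad f (dynkin g) * f] into [f * dynkin g], after which the
    Leibniz rule of [euler] appears. *)
Lemma group_likeM f g : group_like f -> group_like g -> group_like (f * g).
Proof.
case=> f0 Adf df [g0 Adg dg]; split=> [|h|]; first by rewrite smulE0 f0 g0 mulr1.
  by rewrite AdM mulrA Adf -mulrA Adg mulrA.
rewrite dynkinM g0 scale1r mulrDl mulrA Adf -mulrA dg mulrA df eulerM.
exact: addrC.
Qed.

Lemma vanish_sexp1 k f : (0 < k)%N -> homogeneous k f -> vanish 1 (sexp f - 1).
Proof. by move=> k0 hf [|//] _; rewrite saddE soppE sexp_nil subrr. Qed.

(** For h homogeneous of degree m, the defect [phi h] solves E(u) = k f u + m u and has order above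
    m, so it is 0. In general, removing the homogeneous parts of h one by one leaves [phi h]
    unchanged while the order of its argument grows. *)
Lemma Ad_sexp k f h : (0 < k)%N -> homogeneous k f -> lie_like f ->
  Ad (sexp f) h * sexp f = sexp f * h.
Proof.
move=> k0 hf lf; set e := sexp f; pose phi h := Ad e h * e - e * h.
have v1 : vanish 1 (e - 1) := vanish_sexp1 k0 hf.
have phiB h1 h2 : phi (h1 - h2) = phi h1 - phi h2.
  by rewrite /phi AdBr mulrBl mulrBr; sring.
have vphi m h1 : vanish m h1 -> vanish m (phi h1).
  by move=> v; apply: vanishB; [apply/vanishMl/(vanish_Ad (n := 0)) | apply: vanishMr].
have phi_hom m h1 : homogeneous m h1 -> phi h1 = 0.
  move=> hh; have vh := homogeneous_vanish hh.
  set F := k%:R *: f; have hF : homogeneous k F by apply: homogeneousZ.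
  have [_ AdF _] : lie_like F by apply: lie_likeZ.
  have eF : euler e = F * e by rewrite (euler_sexp pK k0 hf) scalerAl.
  apply: (euler_ode_eq0 (n := m) pK k0 hF).
    (* Expressed through e - 1, which has no constant term, the defect has order at least m + 1. *)
    have -> : phi h1 = Ad (e - 1) h1 * e + (h1 * (e - 1) - (e - 1) * h1).
      rewrite -scaleN1r AdDl AdZl Ad1 mulrDl mulrDr mulrDl -!scalerAl -!scalerAr.
      by rewrite mul1r mulr1 /phi; sring.
    apply: vanishD; first by apply/vanishMl; rewrite -add1n; apply: vanish_Ad.
    by apply: vanishB; [rewrite -addn1 | rewrite -add1n]; apply: vanishM.
  rewrite /phi eulerB !eulerM euler_Ad eF AdM AdF (euler_homogeneous hh) AdZr.
  rewrite !(mulrDl, mulrDr, mulrN, mulNr, mulrA) -!scalerAl -!scalerAr.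
  by sring.
apply/eqP; rewrite -subr_eq0; apply/eqP/vanish_eq0 => n.
suff [h1 [vh1 ->]] : exists h1, vanish n h1 /\ Ad e h * e - e * h = phi h1.
  exact: vphi.
elim: n => [|n [h1 [vh1 eh1]]]; first by exists h.
exists (h1 - hpart n h1); split; first exact: vanish_hpart.
by rewrite phiB (phi_hom n (hpart n h1)) ?subr0 //; apply: homogeneous_hpart.
Qed.

Lemma group_like_sexp k f : (0 < k)%N -> homogeneous k f -> lie_like f ->
  group_like (sexp f).
Proof.
move=> k0 hf lf; split; [exact: sexp_nil | by move=> h; apply: Ad_sexp hf lf |].
set e := sexp f; set F := k%:R *: f.
have hF : homogeneous k F by apply: homogeneousZ.
have [F0 AdF dF] : lie_like F by apply: lie_likeZ.
have eF : euler e = F * e by rewrite (euler_sexp pK k0 hf) scalerAl.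
have e0 : e [::] = 1 := sexp_nil f.
apply/eqP; rewrite -subr_eq0; apply/eqP.
apply: (euler_ode_eq0 (n := 0) pK k0 hF).
  apply: vanishB; first by apply/vanishMl/vanish1_dynkin.
  by case=> // _; apply: mul0r.
(* Here r(F e) = [F, r(e)] + E(F) by [dynkinM], so that u = r(e) e - F e satisfies E(u) = F u. *)
rewrite eulerB eulerM euler_dynkin eF dynkinM AdF dF e0 scale1r eulerM eF.
rewrite !(mulrDl, mulrDr, mulrN, mulNr, mulrA) scale0r addr0.
by sring.
Qed.

Lemma homogeneous_euler n f : euler f = n%:R *: f -> homogeneous n f.
Proof.
move=> ef w wn; have /eqP := congr1 (fun f : series K => f w) ef.
rewrite /euler sscaleE -subr_eq0 -mulrBl mulf_eq0 => /orP[|/eqP //].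
have [wn'|nw|eq_wn] := ltngtP (size w) n; last by rewrite eq_wn eqxx in wn.
  rewrite -(subnK (ltnW wn')) natrD opprD addrCA subrr addr0 oppr_eq0.
  by rewrite (negPf (natr_char0_neq0 pK _)) // subn_gt0.
rewrite -(subnK (ltnW nw)) natrD addrK.
by rewrite (negPf (natr_char0_neq0 pK _)) // subn_gt0.
Qed.

Lemma is_lie_poly0 : is_lie_poly (0 : series K).
Proof.
have -> : (0 : series K) = sscale 0 (sX K) by apply/esym/(scale0r (sX K)).
exact/lie_scale/lie_X.
Qed.
Lemma is_lie_poly_var b : is_lie_poly (svar K b).
Proof. by case: b; [apply: lie_Y | apply: lie_X]. Qed.
(** Homogeneity makes the recursion [AdE] stop after n brackets with letters. *)
Lemma is_lie_poly_Ad n f h : homogeneous n f -> is_lie_poly h -> is_lie_poly (Ad f h).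
Proof.
move=> + lh; elim: n f => [|n IHn] f hf; rewrite AdE.
  suff -> : commvar (fun b => Ad (lquo b f) h) = 0 by rewrite addr0; apply: lie_scale.
  apply: big1 => b _; have -> : lquo b f = 0 by apply/funext => w; apply: hf.
  by rewrite Ad0l mulr0 mul0r subrr.
rewrite hf // scale0r add0r; apply: big_ind => [|? ? ? ?|b _].
- exact: is_lie_poly0.
- exact: lie_add.
- by apply: (lie_bracket (is_lie_poly_var b)); apply/IHn/lquo_homogeneous.
Qed.
Lemma is_lie_poly_dynkin n f : homogeneous n.+1 f -> is_lie_poly (dynkin f).
Proof.
move=> hf; apply: big_ind => [|? ? ? ?|b _]; [exact: is_lie_poly0 | exact: lie_add |].
by apply: (is_lie_poly_Ad (n := n)); [apply: rquo_homogeneous | apply: is_lie_poly_var].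
Qed.

Lemma group_like_lead n g : (0 < n)%N -> group_like g -> vanish n (g - 1) ->
  is_lie_poly (hpart n (g - 1)).
Proof.
move=> n0 [_ _ dg] vg; set c := hpart n (g - 1); set t := g - 1 - c.
have hc : homogeneous n c by apply: homogeneous_hpart.
have ec := euler_homogeneous hc.
have vt : vanish n.+1 t by apply: vanish_hpart.
have gE : g = 1 + c + t by rewrite /t; sring.
suff dc : dynkin c = n%:R *: c.
  have -> : c = sscale n%:R^-1 (dynkin c).
    by rewrite dc -[RHS]/(n%:R^-1 *: (n%:R *: c)) scalerA mulVf ?scale1r // natr_char0_neq0.
  by apply: lie_scale; case: (n) n0 hc => // m _; apply: is_lie_poly_dynkin.
apply/eqP; rewrite -subr_eq0; apply/eqP; apply: (@homogeneous_eq0 _ n).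
  by apply: homogeneous_euler; rewrite eulerB euler_dynkin ec dynkinZ eulerZ ec scalerBr.
(* This is r(g) + r(g) (g - 1) = E(g), expanded along g = 1 + c + t. As r(g) has no constant term,
   the product has order at least n + 1. *)
have -> : dynkin c - n%:R *: c =
    euler t - dynkin t - dynkin g * (g - 1).
  rewrite mulrBr mulr1 dg gE !dynkinD dynkin1 !eulerD ec.
  rewrite (euler_homogeneous (@homogeneous1 K)) scale0r !add0r.
  by sring.
apply: vanishB; first by apply: vanishB; [apply: vanish_euler | apply: vanish_dynkin].
by rewrite -add1n; apply: vanishM => //; apply: vanish1_dynkin.
Qed.

End GroupLike.

(** * Lowest-degree parts and convergence of the partial products *)

Section Factorization.
Variable K : fieldType.
Hypothesis pK : [pchar K] =i pred0.
Implicit Types (f g h : series K) (C : nat -> series K) (w : word) (k m n : nat).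

Local Notation half := (2%:R^-1 : K).

Lemma half_double : half + half = 1.
Proof. by rewrite -mulr2n -(mulr_natl half) divff // natr_char0_neq0. Qed.

Lemma homogeneousN k f : homogeneous k f -> homogeneous k (- f).
Proof. by move=> hf w wk; rewrite soppE hf ?oppr0. Qed.

Lemma sexpN_inv k f : (0 < k)%N -> homogeneous k f -> sexp f * sexp (- f) = 1.
Proof. by move=> k0 /homogeneousN hf; rewrite -[f in sexp f]opprK (sexp_inv pK k0). Qed.

Lemma vanish_sexp k f : (0 < k)%N -> homogeneous k f -> vanish k (sexp f - 1).
Proof.
move=> k0 hf; have -> : sexp f - 1 = sexp f - (1 + f) + f by sring.
apply: vanishD (homogeneous_vanish hf).
by apply: (vanishW (leqnSn k)); apply: sexp_lead.
Qed.

Lemma vanish1_sub1 f : f [::] = 1 -> vanish 1 (f - 1).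
Proof. by move=> f0 [|//] _; rewrite saddE soppE f0 subrr. Qed.

Lemma vanish_conj k f g h : (0 < k)%N -> f [::] = 1 -> g [::] = 1 -> vanish k h ->
  vanish k.+1 (f * h * g - h).
Proof.
move=> k0 /vanish1_sub1 vf /vanish1_sub1 vg vh.
have -> : f * h * g - h = (f - 1) * h * g + h * (g - 1).
  by rewrite mulrBr mulr1 !mulrBl mul1r; sring.
apply: vanishD; last by rewrite -addn1; apply: vanishM.
by rewrite -add1n; apply/vanishMl/vanishM.
Qed.

Lemma sexp_sqr_lead k f : (0 < k)%N -> homogeneous k f ->
  vanish k.+1 (sexp f * sexp f - (1 + 2%:R *: f)).
Proof.
move=> k0 hf; have vf := homogeneous_vanish hf; have v := sexp_lead k0 hf.
have -> : sexp f * sexp f - (1 + 2%:R *: f) =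
    2%:R *: (sexp f - (1 + f)) + (sexp f - 1) * (sexp f - 1).
  by rewrite mulrBr mulr1 mulrBl mul1r; sring.
apply: vanishD; first exact: vanishZ.
have v1 := vanish_sexp k0 hf.
by apply: (@vanishW _ _ (k + k)); [rewrite -addn1 leq_add2l | apply: vanishM].
Qed.

(** The effect of inserting the next two factors at the centre of the finite product: outer factors
    with constant term 1 leave the lowest-degree contribution 2 h intact. *)
Lemma sandwich_lead k f g h : (0 < k)%N -> f [::] = 1 -> g [::] = 1 ->
  homogeneous k h ->
  vanish k.+1 (f * sexp h * (sexp h * g) - (f * g + 2%:R *: h)).
Proof.
move=> k0 f0 g0 hh; set s := sexp h * sexp h - (1 + 2%:R *: h).
have vs : vanish k.+1 s by apply: sexp_sqr_lead.
have -> : f * sexp h * (sexp h * g) - (f * g + 2%:R *: h) =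
    f * s * g + (f * (2%:R *: h) * g - 2%:R *: h).
  rewrite -mulrA [sexp h * (_ * _)]mulrA.
  rewrite -[sexp h * sexp h](subrK (1 + 2%:R *: h)) -/s !mulrDl !mulrDr !mulrDl.
  by rewrite !mul1r !mulrA; sring.
apply: vanishD; first by apply/vanishMl/vanishMr.
by apply: vanish_conj => //; apply/vanishZ/homogeneous_vanish.
Qed.

Lemma prod_incE C n : prod_inc C n = \prod_(i <- iota 2 n.-1) sexp (C i).
Proof. by rewrite unlock. Qed.
Lemma prod_decE C n : prod_dec C n = \prod_(i <- rev (iota 2 n.-1)) sexp (C i).
Proof. by rewrite unlock. Qed.

Lemma iota2S n : iota 2 n.+1 = iota 2 n ++ [:: n.+2].
Proof. by rewrite -(addn1 n) iotaD addn1. Qed.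
Lemma prod_incS C n : prod_inc C n.+2 = prod_inc C n.+1 * sexp (C n.+2).
Proof. by rewrite !prod_incE iota2S big_cat big_seq1. Qed.
Lemma prod_decS C n : prod_dec C n.+2 = sexp (C n.+2) * prod_dec C n.+1.
Proof. by rewrite !prod_decE iota2S rev_cat big_cat big_seq1. Qed.

Lemma prod_sexp_nil C (s : seq nat) : (\prod_(i <- s) sexp (C i)) [::] = 1.
Proof.
apply: (big_ind (fun f : series K => f [::] = 1)) => // [f g f0 g0|i _].
  by rewrite smulE0 f0 g0 mulr1.
exact: sexp_nil.
Qed.
Lemma prod_inc_nil C n : prod_inc C n [::] = 1.
Proof. by rewrite prod_incE prod_sexp_nil. Qed.
Lemma prod_dec_nil C n : prod_dec C n [::] = 1.
Proof. by rewrite prod_decE prod_sexp_nil. Qed.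

Definition graded C := forall k, (2 <= k)%N -> homogeneous k (C k).

(** The indices in [prod_inc C n.+1] run from 2 to n + 1, and the next factor is 1 + O(n + 2). *)
Lemma prod_inc_stable C m n : graded C -> (m <= n)%N ->
  vanish m.+2 (prod_inc C n.+1 - prod_inc C m.+1).
Proof.
move=> hC; elim: n => [|n IHn]; first by rewrite leqn0 => /eqP ->; rewrite subrr.
rewrite leq_eqVlt => /predU1P[->|mn]; first by rewrite subrr; apply: vanish0.
have -> : prod_inc C n.+2 - prod_inc C m.+1 = prod_inc C n.+1 * (sexp (C n.+2) - 1) +
    (prod_inc C n.+1 - prod_inc C m.+1).
  by rewrite prod_incS mulrBr mulr1; sring.
apply: vanishD (IHn mn); apply/vanishMr/(@vanishW _ _ n.+2); first exact: mn.
by apply: vanish_sexp => //; apply: hC.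
Qed.
Lemma prod_dec_stable C m n : graded C -> (m <= n)%N ->
  vanish m.+2 (prod_dec C n.+1 - prod_dec C m.+1).
Proof.
move=> hC; elim: n => [|n IHn]; first by rewrite leqn0 => /eqP ->; rewrite subrr.
rewrite leq_eqVlt => /predU1P[->|mn]; first by rewrite subrr; apply: vanish0.
have -> : prod_dec C n.+2 - prod_dec C m.+1 = (sexp (C n.+2) - 1) * prod_dec C n.+1 +
    (prod_dec C n.+1 - prod_dec C m.+1).
  by rewrite prod_decS mulrBl mul1r; sring.
apply: vanishD (IHn mn); apply/vanishMl/(@vanishW _ _ n.+2); first exact: mn.
by apply: vanish_sexp => //; apply: hC.
Qed.

Lemma sconverges_vanish (s : nat -> series K) P :
  (forall m n, (m <= n)%N -> vanish m.+2 (s n.+1 - s m.+1)) ->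
  sconverges s P -> forall n, vanish n.+2 (P - s n.+1).
Proof.
move=> ss sP n w wn; have [N sN] := sP w.
rewrite saddE -(sN (maxn N n).+1); last by rewrite leqW ?leq_maxl.
exact: ss (leq_maxr N n) w wn.
Qed.
(** The coefficient of w is final from the index [(size w).+1] on, so the diagonal is the limit. *)
Lemma sconverges_diag (s : nat -> series K) :
  (forall m n, (m <= n)%N -> vanish m.+2 (s n.+1 - s m.+1)) ->
  sconverges s (fun w => s (size w).+1 w).
Proof.
move=> ss w; exists (size w).+1 => -[//|n] wn.
by have /eqP := ss (size w) n wn w (leqW (leqnn _)); rewrite saddE soppE subr_eq0 => /eqP.
Qed.

(** * The middle factor, uniqueness and the sign symmetry *)

Let hx := half *: sX K.
Let hy := half *: sY K.

(* The product of the e^(C_k) that remains once the exponentials of X/2 and Y/2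
   are moved to the other side. *)
Definition middle : series K :=
  sexp (- hy) * sexp (- hx) * sexp (sX K + sY K) * sexp (- hx) * sexp (- hy).

Lemma homogeneous_hx : homogeneous 1 hx.
Proof. exact/homogeneousZ/homogeneous_var. Qed.
Lemma homogeneous_hy : homogeneous 1 hy.
Proof. exact/homogeneousZ/homogeneous_var. Qed.
Lemma homogeneous_xy : homogeneous 1 (sX K + sY K).
Proof. exact: homogeneousD (@homogeneous_var _ _) (@homogeneous_var _ _). Qed.

Lemma middle_split : sexp (sX K + sY K) =
  sexp hx * (sexp hy * (middle * (sexp hy * sexp hx))).
Proof.
have inv f : homogeneous 1 f -> sexp (- f) * sexp f = 1 by apply: sexp_inv.
have inv' f : homogeneous 1 f -> sexp f * sexp (- f) = 1 by apply: sexpN_inv.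
rewrite /middle -!mulrA [sexp (- hy) * (sexp hy * _)]mulrA inv ?mul1r; last exact: homogeneous_hy.
rewrite inv ?mulr1; last exact: homogeneous_hx.
rewrite [sexp hy * _]mulrA inv' ?mul1r; last exact: homogeneous_hy.
by rewrite mulrA inv' ?mul1r //; apply: homogeneous_hx.
Qed.

Lemma middle_unique f :
  sexp (sX K + sY K) = sexp hx * (sexp hy * (f * (sexp hy * sexp hx))) -> f = middle.
Proof.
have inv g : homogeneous 1 g -> sexp (- g) * sexp g = 1 by apply: sexp_inv.
have inv' g : homogeneous 1 g -> sexp g * sexp (- g) = 1 by apply: sexpN_inv.
rewrite /middle => ->.
rewrite -!mulrA [sexp (- hx) * (sexp hx * _)]mulrA inv ?mul1r; last exact: homogeneous_hx.
rewrite [sexp (- hy) * (sexp hy * _)]mulrA inv ?mul1r; last exact: homogeneous_hy.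
rewrite [sexp hx * (sexp (- hx) * _)]mulrA inv' ?mul1r; last exact: homogeneous_hx.
by rewrite inv' ?mulr1 //; apply: homogeneous_hy.
Qed.

(** The sign automorphism inverts each exponential, and the palindromic shape of [middle] lets the
    factors of the product cancel from the inside outwards. *)
Lemma antip_middle : middle * antip middle = 1.
Proof.
have inv g : homogeneous 1 g -> sexp (- g) * sexp g = 1 by apply: sexp_inv.
have inv' g : homogeneous 1 g -> sexp g * sexp (- g) = 1 by apply: sexpN_inv.
have a1 g : homogeneous 1 g -> antip g = - g.
  by move/antip_homogeneous ->; rewrite expr1 scaleN1r.
have hhx := homogeneous_hx; have hhy := homogeneous_hy.
have hxy := homogeneous_xy.
rewrite /middle !antipM !antip_sexp !a1 ?opprK //; try exact: homogeneousN.
rewrite -!mulrA [sexp (- hy) * (sexp hy * _)]mulrA inv // mul1r.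
rewrite [sexp (- hx) * (sexp hx * _)]mulrA inv // mul1r.
rewrite [sexp (sX K + sY K) * (sexp (- _) * _)]mulrA inv' // mul1r.
by rewrite [sexp (- hx) * (sexp hx * _)]mulrA inv // mul1r inv.
Qed.

(** The linear part is -Y/2 - X/2 + (X + Y) - X/2 - Y/2 = 0. *)
Lemma vanish_middle : vanish 2 (middle - 1).
Proof.
have e1 g b : homogeneous 1 g -> sexp g [:: b] = g [:: b].
  move=> hg; have /eqP := sexp_lead (ltnSn 0) hg (w := [:: b]) (ltnSn 1).
  by rewrite !(saddE, soppE) opprD addrA subr_eq0 subr0 => /eqP.
have m1 f g b : (f * g) [:: b] = f [::] * g [:: b] + f [:: b] * g [::].
  by rewrite smulE big_ord_recl big_ord1.
have hhx := homogeneousN homogeneous_hx; have hhy := homogeneousN homogeneous_hy.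
move=> [|b [|//]] _.
  by rewrite saddE soppE /middle !smulE0 !sexp_nil !mulr1 subrr.
rewrite saddE soppE /middle !(m1, smulE0, sexp_nil, e1) //; last exact: homogeneous_xy.
rewrite /hx /hy !(saddE, soppE, sscaleE) !mulr1 !mul1r subr0.
set x := sX K _; set y := sY K _.
transitivity ((1 - (half + half)) * (x + y)); first by ring.
by rewrite half_double subrr mul0r.
Qed.

(* Equivalent to the factorization, but with finite products only. *)
Definition approx_factorization C :=
  graded C /\ forall n, vanish n.+2 (prod_inc C n.+1 * prod_dec C n.+1 - middle).

(** By strong induction the earlier factors agree. By [sandwich_lead] the next finite products then
    differ by 2 (C k - C' k) up to higher degree, while both approximate [middle]. *)
Lemma approx_factorization_unique C C' :
  approx_factorization C -> approx_factorization C' ->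
  forall k, (2 <= k)%N -> C k = C' k.
Proof.
move=> [hC FC] [hC' FC'] k; elim/ltn_ind: k => -[|[|n]] // IHk _.
have same s : {subset s <= iota 2 n} ->
    \prod_(i <- s) sexp (C i) = \prod_(i <- s) sexp (C' i).
  move=> si; apply: eq_big_seq => i /si; rewrite mem_iota add2n => /andP[i2 ik].
  by rewrite IHk.
have pp : prod_inc C n.+1 = prod_inc C' n.+1 by rewrite !prod_incE same.
have qq : prod_dec C n.+1 = prod_dec C' n.+1.
  by rewrite !prod_decE same // => i; rewrite mem_rev.
have hCk := hC n.+2 isT; have hCk' := hC' n.+2 isT.
have v := sandwich_lead (ltn0Sn _) (prod_inc_nil C n.+1) (prod_dec_nil C n.+1) hCk.
have v' := sandwich_lead (ltn0Sn _) (prod_inc_nil C' n.+1) (prod_dec_nil C' n.+1) hCk'.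
have := FC n.+1; have := FC' n.+1; rewrite !prod_incS !prod_decS => F' F.
apply/eqP; rewrite -subr_eq0; apply/eqP; apply: (@homogeneous_eq0 _ n.+2).
  exact/homogeneousD/homogeneousN.
have := vanishZ half (vanishD (vanishB v' v) (vanishB F F')).
rewrite pp qq; congr (vanish _ _).
apply/funext => w; rewrite !(saddE, soppE, sscaleE).
transitivity ((half + half) * (C n.+2 w - C' n.+2 w)); first by ring.
by rewrite half_double mul1r.
Qed.

Lemma graded_antip C : graded C -> graded (fun k => - antip (C k)).
Proof.
move=> hC k k2; apply: homogeneousN.
by rewrite (antip_homogeneous (hC k k2)); apply/homogeneousZ/hC.
Qed.

(** Inversion reverses a product and negates its exponents, so the automorphism exchanges increasing
    and decreasing products up to inverses. *)
Lemma antip_prod_inv C (s : seq nat) : graded C -> all (leq 2) s ->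
  antip (\prod_(i <- rev s) sexp (C i)) * \prod_(i <- s) sexp (- antip (C i)) = 1.
Proof.
move=> hC; elim: s => [|k s IHs]; first by rewrite !big_nil antip1 mulr1.
move=> /= /andP[k2 /IHs s2]; rewrite rev_cons big_rcons big_cons antipM antip_sexp.
rewrite -mulrA [sexp _ * (sexp _ * _)]mulrA (@sexpN_inv k) ?mul1r // ?(ltnW k2) //.
by rewrite (antip_homogeneous (hC k k2)); apply/homogeneousZ/hC.
Qed.

Lemma approx_factorization_antip C :
  approx_factorization C -> approx_factorization (fun k => - antip (C k)).
Proof.
move=> [hC FC]; split=> [|n]; first exact: graded_antip.
set D := fun k => - antip (C k); set p := prod_inc D _; set q := prod_dec D _.
set p' := antip (prod_inc C n.+1); set q' := antip (prod_dec C n.+1).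
have s2 : all (leq 2) (iota 2 n) by apply/allP => i; rewrite mem_iota => /andP[].
have qp : q' * p = 1 by rewrite /q' /p prod_decE prod_incE antip_prod_inv.
have pq : p' * q = 1.
  have := antip_prod_inv (s := rev (iota 2 n)) hC.
  by rewrite revK all_rev /p' /q prod_decE prod_incE => ->.
(* Since p and q are inverse to q' and p', this exact identity bounds the new error by the image of
   the old one. *)
have -> : p * q - middle = middle * (antip middle - p' * q') * (p * q).
  rewrite mulrBr antip_middle mulrBl mul1r -[middle * _ * _]mulrA.
  by rewrite -[p' * q' * _]mulrA [q' * _]mulrA qp mul1r pq mulr1.
apply/vanishMl/vanishMr; rewrite -opprB; apply/vanishN.
by rewrite /p' /q' -antipM -antipB; apply/vanish_antip/FC.
Qed.

Lemma approx_factorization_even C k : approx_factorization C -> (0 < k)%N ->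
  C k.*2 = 0.
Proof.
move=> FC k0; have k2 : (2 <= k.*2)%N by rewrite (leq_double 1).
have := approx_factorization_unique FC (approx_factorization_antip FC) k2.
rewrite (antip_homogeneous (FC.1 _ k2)) -signr_odd odd_double scale1r => /eqP.
rewrite -addr_eq0 => /eqP CC.
by rewrite -[LHS]scale1r -half_double scalerDl -scalerDr CC scaler0.
Qed.

(** * Passage between infinite and finite products *)

Lemma factorization_approx C :
  symmetric_BCH_factorization C -> approx_factorization C.
Proof.
move=> [LC [P [Q [cP [cQ PQ]]]]].
have hC : graded C by move=> k /LC[].
split=> // n.
have /(_ n) vP := sconverges_vanish (fun m n => prod_inc_stable hC) cP.
have /(_ n) vQ := sconverges_vanish (fun m n => prod_dec_stable hC) cQ.
have <- : P * Q = middle by apply: middle_unique; rewrite PQ -[P * Q * _]mulrA.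
set p := prod_inc _ _ in vP *; set q := prod_dec _ _ in vQ *.
have -> : p * q - P * Q = - ((P - p) * Q + p * (Q - q)).
  by rewrite mulrBl mulrBr; sring.
by apply/vanishN/vanishD; [apply: vanishMl | apply: vanishMr].
Qed.

Lemma approx_factorization_lie C :
  (forall k, (2 <= k)%N -> is_lie_poly (C k)) -> approx_factorization C ->
  symmetric_BCH_factorization C.
Proof.
move=> LC [hC FC]; split=> [k k2|]; first by split; [apply: LC | apply: hC].
have cP := sconverges_diag (fun m n => prod_inc_stable (m := m) (n := n) hC).
have cQ := sconverges_diag (fun m n => prod_dec_stable (m := m) (n := n) hC).
set P : series K := fun w => _ in cP; set Q : series K := fun w => _ in cQ.
exists P, Q; split=> //; split=> //.
suff PQ : P * Q = middle.
  by rewrite [LHS]middle_split -PQ -[P * Q * _]mulrA.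
apply/eqP; rewrite -subr_eq0; apply/eqP/vanish_eq0 => n.
apply: (@vanishW _ _ n.+2); first by rewrite leqW.
have /(_ n) vP := sconverges_vanish (fun m n => prod_inc_stable hC) cP.
have /(_ n) vQ := sconverges_vanish (fun m n => prod_dec_stable hC) cQ.
move: vP vQ (FC n); set p := prod_inc _ _; set q := prod_dec _ _ => vP vQ Fn.
have -> : P * Q - middle = ((P - p) * Q + p * (Q - q)) + (p * q - middle).
  by rewrite mulrBl mulrBr; sring.
by apply: vanishD Fn; apply: vanishD; [apply: vanishMl | apply: vanishMr].
Qed.

(** * Construction of the factors *)

Definition half_lead n f : series K := half *: hpart n (f - 1).

(** [remainder n] is R_(n+2) of the outline above, hence the shift by two here and in [factor]. *)
Fixpoint remainder n : series K :=
  if n is m.+1 then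
    let c := half_lead m.+2 (remainder m) in sexp (- c) * remainder m * sexp (- c)
  else middle.

Definition factor k : series K := half_lead k (remainder k.-2).

Lemma homogeneous_half_lead n f : homogeneous n (half_lead n f).
Proof. exact/homogeneousZ/homogeneous_hpart. Qed.

(** The outer exponentials contribute -2 c in degree n + 2, which cancels the leading part of r -
    1. *)
Lemma vanish_remainder n : vanish n.+2 (remainder n - 1).
Proof.
elim: n => [|n IHn]; first exact: vanish_middle.
rewrite /=; set c := half_lead _ _; set r := remainder n in IHn c *.
have hc : homogeneous n.+2 c by apply: homogeneous_half_lead.
have hcN := homogeneousN hc.
have cE : 2%:R *: c = hpart n.+2 (r - 1).
  by rewrite scalerA divff ?scale1r // natr_char0_neq0.
have -> : sexp (- c) * r * sexp (- c) - 1 =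
    (sexp (- c) * sexp (- c) - (1 + 2%:R *: - c)) +
    (sexp (- c) * (r - 1) * sexp (- c) - (r - 1)) + (r - 1 - hpart n.+2 (r - 1)).
  by rewrite -cE mulrBr mulr1 mulrBl; sring.
apply: vanishD; last exact: vanish_hpart.
by apply: vanishD; [apply: sexp_sqr_lead | apply: vanish_conj; rewrite ?sexp_nil].
Qed.

Lemma group_like_remainder n : group_like (remainder n).
Proof.
elim: n => [|n IHn].
  have glx f : homogeneous 1 f -> is_lie_poly f -> group_like (sexp f).
    by move=> hf lf; apply: (group_like_sexp pK (k := 1)) => //; apply: is_lie_poly_like.
  have lN f : is_lie_poly f -> is_lie_poly (- f) by apply: lie_scale.
  have lx : is_lie_poly hx by apply/lie_scale/lie_X.
  have ly : is_lie_poly hy by apply/lie_scale/lie_Y.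
  have gx := glx _ (homogeneousN homogeneous_hx) (lN _ lx).
  have gy := glx _ (homogeneousN homogeneous_hy) (lN _ ly).
  have gxy := glx _ homogeneous_xy (lie_add (lie_X K) (lie_Y K)).
  by do 4 (apply: group_likeM => //).
rewrite /=; set c := half_lead _ _.
suff gc : group_like (sexp (- c)) by do 2 (apply: group_likeM => //).
apply: (group_like_sexp pK (k := n.+2)) => //.
  exact/homogeneousN/homogeneous_half_lead.
(* One [lie_likeZ] is for the sign, the other for the factor 1/2 in [half_lead]. *)
rewrite -scaleN1r; apply/lie_likeZ/lie_likeZ/is_lie_poly_like.
exact: group_like_lead (@vanish_remainder n).
Qed.

Lemma approx_factorization_factor : approx_factorization factor.
Proof.
have hF : graded factor by move=> k k2; apply: homogeneous_half_lead.
split=> // n; set p := prod_inc _ _; set q := prod_dec _ _.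
(* The peeled factors multiply back to [middle] exactly; the only error comes from replacing the
   central remainder by 1. *)
suff <- : p * remainder n * q = middle.
  have -> : p * q - p * remainder n * q = - (p * (remainder n - 1) * q).
    by rewrite mulrBr mulr1 mulrBl opprB.
  exact/vanishN/vanishMl/vanishMr/vanish_remainder.
rewrite {}/p {}/q; elim: n => [|n <-]; first by rewrite prod_incE prod_decE !big_nil mul1r mulr1.
rewrite prod_incS prod_decS /= -/(factor n.+2).
have inv := sexp_inv pK (ltn0Sn _) (hF n.+2 isT).
have inv' := sexpN_inv (ltn0Sn _) (hF n.+2 isT).
rewrite -!mulrA [sexp (factor _) * (sexp (- _) * _)]mulrA inv' mul1r.
by rewrite [sexp (- factor _) * _]mulrA inv mul1r.
Qed.

Lemma is_lie_poly_factor k : (2 <= k)%N -> is_lie_poly (factor k).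
Proof.
case: k => [|[|n]] // _; apply: lie_scale.
by apply: group_like_lead (group_like_remainder n) (@vanish_remainder n).
Qed.

End Factorization.

Theorem theorem1 (K : fieldType) (hK : [pchar K] =i pred0) :
  exists C : nat -> series K,
    symmetric_BCH_factorization C /\
    (forall C' : nat -> series K, symmetric_BCH_factorization C' ->
       forall k, (2 <= k)%N -> C' k = C k) /\
    (forall k, (1 <= k)%N -> C (k.*2) = szero K).
Proof.
have FC := approx_factorization_factor hK.
exists (@factor K); split; first exact: approx_factorization_lie (is_lie_poly_factor hK) FC.
split=> [C' FC'|k k1]; last exact: approx_factorization_even.
exact: approx_factorization_unique (factorization_approx hK FC') FC.
Qed.
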